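(* Let $K$ be a non-trivial finite abelian group, and consider the right Bernoulli shift $\beta_K:K^{\mathbb N}\to K^{\mathbb N}$, the left Bernoulli shift ${}_K\beta:K^{\mathbb N}\to K^{\mathbb N}$ and the two-sided Bernoulli shift $\overline\beta_K:K^{\mathbb Z}\to K^{\mathbb Z}$. Then $$\mathrm{ent}(\beta_K)=\mathrm{ent}({}_K\beta)=\mathrm{ent}(\overline\beta_K)=\infty.$$
   Context: The Bernoulli shifts are defined by $\beta_K(x_0,x_1,x_2,\ldots)=(0,x_0,x_1,\ldots)$, ${}_K\beta(x_0,x_1,x_2,\ldots)=(x_1,x_2,x_3,\ldots)$ and $\overline\beta_K((x_n)_{n\in\mathbb Z})=(x_{n-1})_{n\in\mathbb Z}$. Algebraic entropy: for an abelian group $G$, an endomorphism $\phi:G\to G$, a finite subgroup $F$ of $G$ and a positive integer $n$, let $T_n(\phi,F)=F+\phi(F)+\ldots+\phi^{n-1}(F)$, $H(\phi,F)=\lim_{n\to\infty}\frac{\log|T_n(\phi,F)|}{n}$ (the limit exists), and $\mathrm{ent}(\phi)=\sup\{H(\phi,F):F\text{ a finite subgroup of }G\}\in[0,\infty]$. *)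

(* Defs.v *)
From HB Require Import structures.
From mathcomp Require Import all_boot all_order all_algebra.
From mathcomp Require Import finmap.
From mathcomp Require Import all_classical all_reals all_analysis.

Set Implicit Arguments.
Unset Strict Implicit.
Unset Printing Implicit Defensive.

Import Order.TTheory GRing.Theory Num.Theory.
Import numFieldNormedType.Exports.

Local Open Scope classical_set_scope.
Local Open Scope ring_scope.

Section AlgebraicEntropy.
Variables (R : realType) (G : zmodType).
Implicit Types (phi : {additive G -> G}) (A B F : {fset G}).

Definition sumset A B : {fset G} := [fset (x + y)%R | x in A, y in B]%fset.

Definition trajectory phi F (n : nat) : {fset G} :=
  \big[sumset/[fset 0%R]%fset]_(i < n) [fset iter i phi x | x in F]%fset.

(* The limit exists for every finite subgroup F; the term n = 0 is irrelevant. *)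
Definition entropy_along phi F : R :=
  limn (fun n => ln #|` trajectory phi F n|%:R / n%:R).

(* [zmod_closed] says that F is a subgroup: it contains 0 and is closed under
   differences. *)
Definition ent phi : \bar R :=
  ereal_sup [set (entropy_along phi F)%:E
            | F in [set F : {fset G} | zmod_closed [in F]]].

End AlgebraicEntropy.

Arguments ent R {G} phi.

Section BernoulliShifts.
Variable K : zmodType.

Definition right_shift (x : nat -> K) : nat -> K :=
  fun n => if n is m.+1 then x m else 0.

Definition left_shift (x : nat -> K) : nat -> K := fun n => x n.+1.

Definition bilateral_shift (x : int -> K) : int -> K := fun n => x (n - 1).

Lemma right_shift_is_zmod_morphism : zmod_morphism right_shift.
Proof. by move=> x y; apply/funext => -[|n] //=; rewrite !fctE /= ?subr0. Qed.

Lemma left_shift_is_zmod_morphism : zmod_morphism left_shift.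
Proof. by []. Qed.

Lemma bilateral_shift_is_zmod_morphism : zmod_morphism bilateral_shift.
Proof. by []. Qed.

HB.instance Definition _ := GRing.isZmodMorphism.Build (nat -> K) (nat -> K)
  right_shift right_shift_is_zmod_morphism.
HB.instance Definition _ := GRing.isZmodMorphism.Build (nat -> K) (nat -> K)
  left_shift left_shift_is_zmod_morphism.
HB.instance Definition _ := GRing.isZmodMorphism.Build (int -> K) (int -> K)
  bilateral_shift bilateral_shift_is_zmod_morphism.

End BernoulliShifts.

Arguments right_shift K x : clear implicits.
Arguments left_shift K x : clear implicits.
Arguments bilateral_shift K x : clear implicits.

(* Main.v *)
Require Import Defs.
From HB Require Import structures.
From mathcomp Require Import all_boot all_order all_algebra.
From mathcomp Require Import finmap zify.
From mathcomp Require Import all_classical all_reals all_analysis.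

Set Implicit Arguments.
Unset Strict Implicit.
Unset Printing Implicit Defensive.

Local Open Scope ring_scope.
Import Order.TTheory GRing.Theory Num.Theory.
Import numFieldNormedType.Exports.

(** A subgroup F whose images F, phi F, phi^2 F, ... are independent has
    |T_n(phi, F)| = |F|^n, hence entropy log |F|.  For the three shifts such
    subgroups of order |K|^m exist for every m: send k in K^m to the sequence
    with value k_(q mod m) at each position 2^q and 0 elsewhere.  As the gaps
    between powers of 2 grow, near 2^q a sum of n shifted sequences of this kind
    has at most one nonzero term, so every coordinate can be read off. *)

Section IndependentTrajectory.
Variables (R : realType) (G : zmodType) (V : finZmodType).
Variable phi : {additive G -> G}.

(** Presents the sumset as the image of one map on [V ^ n], so that counting it reduces to
    injectivity. The induction splits a family into its value at [ord0] and the rest. *)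
Lemma big_sumset (n : nat) (h : 'I_n -> V -> G) :
  \big[@sumset G/[fset 0]%fset]_(i < n) [fset h i v | v in V]%fset
  = [fset \sum_(i < n) h i (v i) | v : {ffun 'I_n -> V} in {ffun 'I_n -> V}]%fset.
Proof.
elim: n h => [|n IHn] h.
  apply/fsetP => y; rewrite big_ord0 inE; apply/eqP/imfsetP => [->|[v _ ->]].
    by exists [ffun=> 0] => //; rewrite big_ord0.
  by rewrite big_ord0.
rewrite big_ord_recl IHn; apply/fsetP => y; apply/imfset2P/imfsetP.
  move=> [_ /imfsetP[a _ ->] [_ /imfsetP[v _ ->] ->]].
  exists [ffun i => if unlift ord0 i is Some j then v j else a] => //.
  rewrite big_ord_recl ffunE unlift_none; congr (_ + _).
  by apply: eq_bigr => i _; rewrite ffunE liftK.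
move=> [v _ ->]; rewrite big_ord_recl.
exists (h ord0 (v ord0)); first by apply/imfsetP; exists (v ord0).
exists (\sum_(i < n) h (lift ord0 i) (v (lift ord0 i))) => //.
apply/imfsetP; exists [ffun i => v (lift ord0 i)] => //.
by apply: eq_bigr => i _; rewrite ffunE.
Qed.

Variable f : {additive V -> G}.
Hypothesis indep : forall (n : nat) (v w : 'I_n -> V),
  \sum_(i < n) iter i phi (f (v i)) = \sum_(i < n) iter i phi (f (w i)) ->
  v =1 w.

Lemma card_trajectory_independent (n : nat) :
  #|` trajectory phi [fset f v | v in V]%fset n| = (#|V| ^ n)%N.
Proof.
have -> : trajectory phi [fset f v | v in V]%fset n =
    \big[@sumset G/[fset 0]%fset]_(i < n) [fset iter i phi (f v) | v in V]%fset.
  apply: eq_bigr => i _; apply/fsetP => y; apply/imfsetP/imfsetP.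
    by move=> [_ /imfsetP[v _ ->] ->]; exists v.
  by move=> [v _ ->]; exists (f v) => //; apply/imfsetP; exists v.
rewrite big_sumset card_imfset /=.
  by rewrite -cardE card_ffun card_ord.
by move=> v w /indep vw; apply/ffunP.
Qed.

Lemma entropy_along_independent :
  entropy_along R phi [fset f v | v in V]%fset = ln #|V|%:R.
Proof.
rewrite /entropy_along; apply: cvg_lim => //; apply: cvg_near_cst.
(* The quotient is constant only from [n = 1] on; at [n = 0] it is a division by zero. *)
exists 1%N => // n /= n_gt0.
rewrite card_trajectory_independent natrX lnXn ?ltr0n; last first.
  by apply/card_gt0P; exists 0.
by rewrite -(mulr_natr (ln _)) mulfK // pnatr_eq0 -lt0n.
Qed.

Lemma ent_ge_independent : ((ln #|V|%:R)%:E <= ent R phi)%E.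
Proof.
apply: ereal_sup_ubound; exists [fset f v | v in V]%fset => /=; last first.
  by rewrite entropy_along_independent.
split=> [|x y]; first by apply/imfsetP; exists 0; rewrite ?raddf0.
move=> /imfsetP[v _ ->] /imfsetP[w _ ->].
by apply/imfsetP; exists (v - w); rewrite ?raddfB.
Qed.

End IndependentTrajectory.

Section SparseSequence.
Variables (K : finZmodType) (m : nat).
Local Notation V := 'rV[K]_m.+1.

(** Cycling through the coordinates of [v] makes each of them recur arbitrarily far out, where the
    gaps exceed any given number of shifts. *)
Definition sparse (v : V) (p : nat) : K :=
  let q := trunc_log 2 p in
  if p == (2 ^ q)%N then v 0 (inord (q %% m.+1)) else 0.

Lemma sparse_is_zmod_morphism : zmod_morphism sparse.
Proof.
move=> v w; apply/funext => p; rewrite !fctE /sparse.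
by case: ifP; rewrite ?subr0 // !mxE.
Qed.

HB.instance Definition _ :=
  GRing.isZmodMorphism.Build V (nat -> K) sparse sparse_is_zmod_morphism.

Definition sparsez (v : V) (z : int) : K := if z is Posz p then sparse v p else 0.

Lemma sparsez_is_zmod_morphism : zmod_morphism sparsez.
Proof.
move=> v w; apply/funext => -[p|p]; rewrite !fctE /sparsez ?subr0 //.
by rewrite raddfB.
Qed.

HB.instance Definition _ :=
  GRing.isZmodMorphism.Build V (int -> K) sparsez sparsez_is_zmod_morphism.

Lemma sparse_between (v : V) (q p : nat) :
  (2 ^ q < p < 2 ^ q.+1)%N -> sparse v p = 0.
Proof.
move=> /andP[qp pq]; rewrite /sparse (@trunc_log_eq 2 q) ?(ltnW qp) //.
by rewrite gtn_eqF.
Qed.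

Lemma sparse_near (n : nat) (j : 'I_m.+1) (a b : 'I_n) (v : V) :
  sparse v (2 ^ (n * m.+1 + j) + a - b) = if a == b then v 0 j else 0.
Proof.
set q := (n * m.+1 + j)%N.
have nq : (n <= q)%N by rewrite /q; nia.
case: eqVneq => [->|].
  rewrite addnK /sparse trunc_expnK // eqxx; congr (v 0 _).
  by rewrite modnMDl modn_small // inord_val.
rewrite -val_eqE /= => /eqP ab.
have := ltn_ord a; have := ltn_ord b => bn an.
(* The exponent is now [q.+1], and [a], [b] differ by at most [n - 1 <= q < 2 ^ q], less than the
   distance to either neighbouring power of 2. *)
case: q nq => [|q] nq; first by lia.
have q2 := ltn_expl q (ltnSn 1).
have := expnS 2 q; have := expnS 2 q.+1 => e1 e2.
have [ltab|ltba] : (a < b)%N \/ (b < a)%N by lia.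
- by apply: (@sparse_between _ q); lia.
- by apply: (@sparse_between _ q.+1); lia.
Qed.

(** At [p i j] only the [i]-th summand survives, and it shows coordinate [j] of [v i]. The index
    type is left open to serve both [nat] and [int]. *)
Lemma sparse_separated (T : Type) (n : nat) (h : 'I_n -> V -> T -> K)
    (p : 'I_n -> 'I_m.+1 -> T) :
  (forall i j b v, h b v (p i j) = if i == b then v 0 j else 0) ->
  forall v w : 'I_n -> V,
  \sum_(i < n) h i (v i) = \sum_(i < n) h i (w i) -> v =1 w.
Proof.
move=> hp.
have read (v : 'I_n -> V) i j : (\sum_(b < n) h b (v b)) (p i j) = v i 0 j.
  rewrite fct_sumE (bigD1 i) //= hp eqxx big1 ?addr0 // => b /negPf.
  by rewrite eq_sym hp => ->.
by move=> v w vw i; apply/rowP => j; rewrite -read vw read.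
Qed.

End SparseSequence.

Section Shifts.
Variable K : zmodType.

Lemma iter_right_shift (i p : nat) (x : nat -> K) :
  (i <= p)%N -> iter i (right_shift K) x p = x (p - i)%N.
Proof.
by elim: i p => [|i IHi] [|p] //= ip; rewrite IHi.
Qed.

Lemma iter_left_shift (i p : nat) (x : nat -> K) :
  iter i (left_shift K) x p = x (p + i)%N.
Proof.
by elim: i p => [|i IHi] p; rewrite ?addn0 //= /left_shift IHi addSnnS.
Qed.

Lemma iter_bilateral_shift (i : nat) (z : int) (x : int -> K) :
  iter i (bilateral_shift K) x z = x (z - i%:Z).
Proof.
elim: i z => [|i IHi] z; rewrite ?subr0 //= /bilateral_shift IHi.
by congr x; lia.
Qed.

End Shifts.

Lemma ge_ln_card_rV_pinfty (R : realType) (K : finZmodType) (e : \bar R) :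
  (1 < #|K|)%N ->
  (forall m : nat, ((ln #|'rV[K]_m.+1|%:R)%:E <= e)%E) -> e = +oo%E.
Proof.
move=> K1 le_e; apply: eq_infty => r.
have lnK : 0 < ln (#|K|%:R : R) by rewrite ln_gt0 // ltr1n.
(* Since [ln #|V| = m.+1 * ln #|K|], it suffices that [m] exceeds [r / ln #|K|]. *)
pose m := Num.bound (`|r / ln #|K|%:R|).
apply: le_trans (le_e m); rewrite lee_fin card_mx mul1n natrX lnXn; last first.
  by rewrite ltr0n ltnW.
rewrite -(mulr_natl (ln _)) -ler_pdivrMr //.
apply: le_trans (ler_norm _) _; apply: ltW.
apply: lt_le_trans (archi_boundP (normr_ge0 _)) _.
by rewrite ler_nat.
Qed.

Theorem corollary6p5 (R : realType) (K : finZmodType) (hK : (1 < #|K|)%N) :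
  [/\ ent R (right_shift K) = +oo%E,
      ent R (left_shift K) = +oo%E
    & ent R (bilateral_shift K) = +oo%E].
Proof.
(* These two bounds ensure that no subtraction of positions below is truncated. *)
have le_exp n (i : 'I_n) m (j : 'I_m.+1) : (i <= 2 ^ (n * m.+1 + j))%N.
  apply: leq_trans (ltnW (ltn_expl _ (ltnSn 1))).
  by have := ltn_ord i; nia.
have le_exp_add n (i b : 'I_n) m (j : 'I_m.+1) :
    (b <= 2 ^ (n * m.+1 + j) + i)%N.
  exact: leq_trans (le_exp n b m j) (leq_addr _ _).
split; apply: (ge_ln_card_rV_pinfty hK) => m.
(* The [i]-th right shift moves the entry at a power of 2 up by [i], so it is read there. *)
- apply: (@ent_ge_independent R _ 'rV[K]_m.+1 _ (@sparse K m)) => n.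
  apply: (@sparse_separated K m nat n
    (fun i v => iter i (right_shift K) (sparse v))
    (fun i j => (2 ^ (n * m.+1 + j) + i)%N)) => i j b v.
  by rewrite iter_right_shift ?sparse_near.
(* Entries now move down by [i], which swaps the two indices in [sparse_near]. *)
- apply: (@ent_ge_independent R _ 'rV[K]_m.+1 _ (@sparse K m)) => n.
  apply: (@sparse_separated K m nat n
    (fun i v => iter i (left_shift K) (sparse v))
    (fun i j => (2 ^ (n * m.+1 + j) - i)%N)) => i j b v.
  by rewrite iter_left_shift addnBAC // sparse_near eq_sym.
(* The reading points of the right shift work again: after shifting back they stay nonnegative,
   where [sparsez] agrees with [sparse]. *)
- apply: (@ent_ge_independent R _ 'rV[K]_m.+1 _ (@sparsez K m)) => n.
  apply: (@sparse_separated K m int n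
    (fun i v => iter i (bilateral_shift K) (sparsez v))
    (fun i j => (2 ^ (n * m.+1 + j) + i)%N%:Z)) => i j b v.
  by rewrite iter_bilateral_shift subzn //= sparse_near.
Qed.
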